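(* If there exists $\bar{x}\in P$ such that $A\bar{x}-b\in\mathrm{core}\,Q$, then $\mathcal{K}=\mathcal{M}$.
   Context: Setting: $X$ and $Z$ are real vector spaces with algebraic duals $X^*$ and $Z^*$ (all linear functionals), with the evaluation pairings $\langle x,x^*\rangle=x^*(x)$ and $\langle z,z^*\rangle=z^*(z)$. $A:X\to Z$ is linear, with adjoint $A^*:Z^*\to X^*$ given by $\langle x,A^*z^*\rangle=\langle Ax,z^*\rangle$. $P\subset X$ and $Q\subset Z$ are convex cones (nonempty, and $\alpha u+\beta v$ is in the cone for all $\alpha,\beta\ge0$ and $u,v$ in the cone); $b\in Z$, $c\in X^*$. Dual cones: $P^*=\{y\in X^*:\langle x,y\rangle\ge0\ \forall x\in P\}$, $Q^*=\{w\in Z^*:\langle q,w\rangle\ge0\ \forall q\in Q\}$. Feasible sets: $F(\mathcal{P})=\{x\in P:Ax-b\in Q\}$ and $F(\mathcal{D})=\{w\in Q^*:-A^*w+c\in P^*\}$; both are assumed nonempty. Definitions: for a subset $S$ of a real vector space $E$, the algebraic core is $\mathrm{core}\,S=\{u\in E:\forall v\in E\ \exists t_0>0\text{ such that }u+tv\in S\text{ whenever }0\le t\le t_0\}$. $\mathcal{K}=\bigcup_{w\in Q^*}\big((-A^*w+c-P^* )\times\,]-\infty,\langle b,w\rangle]\big)\subset X^*\times\mathbb{R}$; $v_{\mathcal{P}}(y)=\inf\{\langle x,c-y\rangle:x\in F(\mathcal{P})\}$ for $y\in X^*$ (possibly $-\infty$); $\mathcal{M}=\mathrm{hypo}\,v_{\mathcal{P}}=\{(y,r)\in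 X^*\times\mathbb{R}:r\le v_{\mathcal{P}}(y)\}$. *)

(* Defs.v *)
From HB Require Import structures.
From mathcomp Require Import all_boot all_order all_algebra.
From mathcomp Require Import all_classical all_reals ereal.

Set Implicit Arguments.
Unset Strict Implicit.
Unset Printing Implicit Defensive.

Import Order.TTheory GRing.Theory Num.Theory.

Local Open Scope classical_set_scope.
Local Open Scope ring_scope.

(* No topology: every linear functional belongs to the dual. *)
Definition algdual (R : realType) (E : lmodType R) := {scalar E}.

Section AlgDualZmodule.
Context (R : realType) (E : lmodType R).
Implicit Types f g h : algdual E.

Lemma algdualP f g : (forall x, f x = g x) -> f = g.
Proof.
case: f g => [f [[f1] [f2]]] [g [[g1] [g2]]] /= /funext fg; subst g.
by rewrite (Prop_irrelevance f1 g1) (Prop_irrelevance f2 g2).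
Qed.

HB.instance Definition _ := gen_eqMixin (algdual E).
HB.instance Definition _ := gen_choiceMixin (algdual E).

Definition algdual0 : algdual E := (\0 : {scalar E}).
Definition algdual_opp f : algdual E := (\- (f : {scalar E}) : {scalar E}).
Definition algdual_add f g : algdual E :=
  ((f : {scalar E}) \+ (g : {scalar E}) : {scalar E}).

Let addA : associative algdual_add.
Proof. by move=> f g h; apply: algdualP => x; rewrite /= addrA. Qed.
Let addC : commutative algdual_add.
Proof. by move=> f g; apply: algdualP => x; rewrite /= addrC. Qed.
Let add0 : left_id algdual0 algdual_add.
Proof. by move=> f; apply: algdualP => x; rewrite /= add0r. Qed.
Let addN : left_inverse algdual0 algdual_opp algdual_add.
Proof. by move=> f; apply: algdualP => x; rewrite /= addNr. Qed.

HB.instance Definition _ :=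
  GRing.isZmodule.Build (algdual E) addA addC add0 addN.

Lemma algdualDE f g x : (f + g) x = f x + g x. Proof. by []. Qed.
Lemma algdualNE f x : (- f) x = - f x. Proof. by []. Qed.
Lemma algdualBE f g x : (f - g) x = f x - g x. Proof. by []. Qed.

End AlgDualZmodule.

Definition adjoint (R : realType) (X Z : lmodType R) (A : {linear X -> Z})
  (w : algdual Z) : algdual X := ((w : {scalar Z}) \o A : {scalar X}).

Definition convex_cone (R : realType) (E : lmodType R) (C : set E) :=
  C !=set0 /\
  forall (a b : R) (u v : E), 0 <= a -> 0 <= b -> C u -> C v ->
    C (a *: u + b *: v).

Definition dual_cone (R : realType) (E : lmodType R) (C : set E) :
    set (algdual E) :=
  [set y : algdual E | forall x, C x -> 0 <= y x].

Definition core (R : realType) (E : lmodType R) (S : set E) : set E :=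
  [set u | forall v : E, exists2 t0 : R, 0 < t0 &
    forall t : R, 0 <= t <= t0 -> S (u + t *: v)].

Definition hypo (R : realType) (T : Type) (f : T -> \bar R) : set (T * R) :=
  [set p | (p.2%:E <= f p.1)%E].

Section ConicProgram.
Context (R : realType) (X Z : lmodType R).
Variables (A : {linear X -> Z}) (P : set X) (Q : set Z) (b : Z)
  (c : algdual X).

Definition feasible_primal : set X := [set x | P x /\ Q (A x - b)].

Definition feasible_dual : set (algdual Z) :=
  [set w | dual_cone Q w /\ dual_cone P (- adjoint A w + c)].

Definition Kset : set (algdual X * R) :=
  \bigcup_(w in dual_cone Q)
    ([set - adjoint A w + c - p | p in dual_cone P] `*`
     [set r : R | r <= w b]).

Definition value_primal (y : algdual X) : \bar R :=
  ereal_inf [set ((c - y) x)%:E | x in feasible_primal].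

Definition Mset : set (algdual X * R) := hypo value_primal.

End ConicProgram.

(* Main.v *)
Require Import Defs.
From HB Require Import structures.
From mathcomp Require Import all_boot all_order all_algebra.
From mathcomp Require Import all_classical all_reals ereal.
From mathcomp Require Import lra.

Set Implicit Arguments.
Unset Strict Implicit.
Unset Printing Implicit Defensive.

Import Order.TTheory GRing.Theory Num.Theory.

Local Open Scope classical_set_scope.
Local Open Scope ring_scope.

(** The inclusion of [Kset] in [Mset] is weak duality: if [y] is
    [- A^* w + c - p] then [(c - y) x = w (A x) + p x >= w b] for every
    primal feasible [x].

    Conversely, a point [(y, r)] of [Mset] says that the functional
    [g = c - y] is at least [r] on the primal feasible set, and it is in
    [Kset] as soon as some [w] in the dual cone of [Q] satisfies
    [w (A x) <= g x] on [P] and [r <= w b].  These three requirements on [w]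
    say together that the graph of [w] lies below the convex cone

      [{(z, g x - t r) | x in P, t >= 0, A x - t b - z in Q}]

    of [Z * R] ([perturbation_cone]): they are read off at its points
    with [x = 0] and [t = 0], with [z = A x] and [t = 0], and with [x = 0],
    [t = 1] and [z = - b].  The bound on [g] is what keeps this cone from
    going below [0] over the origin ([nonneg_over0_perturbation]).  The
    point [xbar]
    makes the cone nonempty over every [z]: some [A xbar - b - e z] with
    [e > 0] is in [Q], and one divides by [e]
    ([perturbation_cone_total]).  A cone with these two properties has a
    linear functional below it; this is the Hahn-Banach theorem in geometric
    form ([hahn_banach_cone]).  As no topology is involved, any linear
    functional will do, which is why a core point suffices.

    Hahn-Banach is proved by enlarging the cone with Zorn's lemma.  In a
    maximal cone that stays nonnegative over the origin, the points [v] such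
    that both [v] and [- v] belong to it form the graph of the functional. *)

(** * Convex cones and their enlargement by a ray *)

Section ConvexCone.
Context (R : realType) (E : lmodType R).
Implicit Types (C : set E) (u v : E).

Lemma convex_coneD C u v : convex_cone C -> C u -> C v -> C (u + v).
Proof.
by move=> [_ cC] Cu Cv; have := cC 1 1 u v ler01 ler01 Cu Cv; rewrite !scale1r.
Qed.

Lemma convex_coneZ C (a : R) u : convex_cone C -> 0 <= a -> C u -> C (a *: u).
Proof.
by move=> [_ cC] a0 Cu; have := cC a 0 u u a0 (lexx 0) Cu Cu;
  rewrite scale0r addr0.
Qed.

Lemma convex_cone0 C : convex_cone C -> C 0.
Proof.
by move=> cC; have [u Cu] := cC.1; rewrite -(scale0r u); exact: convex_coneZ.
Qed.

Definition adjoin_ray C v : set E :=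
  [set u | exists g t, [/\ C g, 0 <= t & u = g + t *: v]].

Lemma convex_cone_adjoin_ray C v :
  convex_cone C -> convex_cone (adjoin_ray C v).
Proof.
move=> cC; split.
  by exists 0, 0, 0; rewrite scale0r addr0; split => //; exact: convex_cone0.
move=> a b _ _ a0 b0 [g [t [Cg t0 ->]]] [h [s [Ch s0 ->]]].
exists (a *: g + b *: h), (a * t + b * s); split.
- exact: cC.2.
- by rewrite addr_ge0 ?mulr_ge0.
- by rewrite !scalerDr !scalerA scalerDl addrACA.
Qed.

Lemma sub_adjoin_ray C v : C `<=` adjoin_ray C v.
Proof. by move=> u Cu; exists u, 0; rewrite scale0r addr0. Qed.

Lemma mem_adjoin_ray C v : convex_cone C -> adjoin_ray C v v.
Proof.
by move=> cC; exists 0, 1; rewrite scale1r add0r ler01; split => //;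
  exact: convex_cone0.
Qed.

End ConvexCone.

(** * The Hahn-Banach theorem for cones *)

Section HahnBanach.
Context (R : realType) (E : lmodType R).
Implicit Types (C M : set (E * R^o)).

(** For a cone that contains [(z, r)] and [(- z, s)], this forces
    [- s <= r], so that the bounds [w z <= r] and [w (- z) <= s] on a linear
    functional [w] are compatible. *)
Definition nonneg_over0 C := forall r : R, C (0, r) -> 0 <= r.

(** Both conditions bear on at most two points of the cone at a time, so
    they pass to unions of chains and Zorn's lemma applies.  A vector whose
    ray can be adjoined without going below [0] over the origin is then
    already present, by maximality. *)
Lemma maximal_nonneg_over0_cone C : convex_cone C -> nonneg_over0 C ->
  exists M, [/\ C `<=` M, convex_cone M, nonneg_over0 M &
    forall v, nonneg_over0 (adjoin_ray M v) -> M v].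
Proof.
move=> cC C0.
(* The empty chain has union [set0], which is not a cone, so Zorn's lemma is
   applied to the sets of points added to [C]. *)
pose good (G : set (E * R^o)) :=
  convex_cone (C `|` G) /\ nonneg_over0 (C `|` G).
have chain F : F `<=` good -> total_on F subset -> good (\bigcup_(G in F) G).
  move=> Fgood Ftot.
  have common u v : (C `|` \bigcup_(G in F) G) u ->
      (C `|` \bigcup_(G in F) G) v ->
      exists G, [/\ convex_cone (C `|` G),
        G `<=` \bigcup_(G in F) G, (C `|` G) u & (C `|` G) v].
    move=> [Cu|[G FG Gu]] [Cv|[H FH Hv]].
    - by exists set0; rewrite setU0; split => //; exact: sub0set.
    - exists H; split; [exact: (Fgood _ FH).1|exact: bigcup_sup|
        by left|by right].
    - exists G; split; [exact: (Fgood _ FG).1|exact: bigcup_sup|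
        by right|by left].
    - have [GH|HG] := Ftot _ _ FG FH.
      + exists H; split; [exact: (Fgood _ FH).1|exact: bigcup_sup| |by right].
        by right; exact: GH.
      + exists G; split; [exact: (Fgood _ FG).1|exact: bigcup_sup|by right|].
        by right; exact: HG.
  split; first split.
  - by have [u Cu] := cC.1; exists u; left.
  - move=> a b u v a0 b0 /common/[apply] -[G [cG sG Gu Gv]].
    exact: (setUS sG) (cG.2 a b u v a0 b0 Gu Gv).
  - move=> r [/C0//|[G FG Gr]].
    by apply: (Fgood _ FG).2; right.
have [G [[cM M0] maxG]] := Zorn_bigcup chain.
exists (C `|` G); split => // v Mv0; apply: contrapT => nMv.
pose M' := adjoin_ray (C `|` G) v.
have sM : C `|` G `<=` M' by exact: sub_adjoin_ray.
have CM' : C `|` M' = M' by apply/setUidPr => u Cu; apply: sM; left.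
apply: (maxG M').
  split; first by move=> u Gu; apply: sM; right.
  by move=> M'G; apply: nMv; right; apply: M'G; exact: mem_adjoin_ray.
by rewrite /good CM'; split => //; exact: convex_cone_adjoin_ray.
Qed.

(** Geometric form of Hahn-Banach: a sublinear function that dominates the
    functional is replaced by its epigraph, and more generally by any cone
    that is total over [E], so that no infimum has to be shown sublinear. *)
Lemma hahn_banach_cone C : convex_cone C -> nonneg_over0 C ->
  (forall z, exists r, C (z, r)) ->
  exists w : algdual E, forall z r, C (z, r) -> w z <= r.
Proof.
move=> cC C0 Cdom.
have [M [CM cM M0 Mmax]] := maximal_nonneg_over0_cone cC C0.
have Mdom z : exists r, M (z, r) by have [r /CM] := Cdom z; exists r.
have gap z r s : M (z, r) -> M (- z, - s) -> s <= r.
  move=> Mr Ms; have : M (z - z, r - s) := convex_coneD cM Mr Ms.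
  by rewrite subrr => /M0; rewrite subr_ge0.
(* Adjoining [(z, r)] only creates the new points [(0, t * (s + r))] over the
   origin, where [(- z, s)] is in [M]. *)
have absorb z r : (forall s, M (- z, s) -> 0 <= r + s) -> M (z, r).
  move=> rP; apply: Mmax => q [[g1 g2] [t [Mg t0 [gz ->]]]].
  move: t0; rewrite le_eqVlt => /predU1P[t0|t0].
    by move: gz Mg; rewrite -t0 !scale0r !addr0 => <-; exact: M0.
  have ti : 0 <= t^-1 by rewrite invr_ge0 ltW.
  have : M (t^-1 *: g1, t^-1 * g2) := convex_coneZ cM ti Mg.
  have -> : t^-1 *: g1 = - z.
    move/eqP: gz; rewrite eq_sym addr_eq0 => /eqP ->.
    by rewrite scalerN scalerA mulVf ?gt_eqF// scale1r.
  move=> /rP; rewrite -(pmulr_rge0 _ t0) mulrDr mulrA mulfV ?gt_eqF// mul1r.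
  by rewrite addrC.
(* The value at [z] is the lower boundary of [M] over [z].  It is finite
   because [M] is nonempty over [- z], and it is attained by maximality. *)
have line z : exists r, M (z, r) /\ M (- z, - r).
  pose S : set R := [set r | M (z, r)].
  have S0 : nonempty S by exact: Mdom.
  have lbS s : M (- z, s) -> lbound S (- s).
    by move=> Ms r Mr; apply: gap Mr _; rewrite opprK.
  have hlb : has_lbound S by have [s /lbS] := Mdom (- z); exists (- s).
  exists (inf S); split; apply: absorb => s.
    by move=> /lbS/(lb_le_inf S0); rewrite -subr_ge0 opprK.
  by rewrite opprK addrC subr_ge0 => Ms; exact: ge_inf.
(* Since such a value is unique, linearity of [f] follows from [M] being a
   cone. *)
pose f z := projT1 (cid (line z)).
have fP z : M (z, f z) /\ M (- z, - f z) by exact: projT2 (cid (line z)).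
have f_uniq z r : M (z, r) -> M (- z, - r) -> f z = r.
  move=> Mr MNr; have [Mf MNf] := fP z.
  by apply: le_anti; rewrite (gap _ _ _ Mr MNf) (gap _ _ _ Mf MNr).
have fD x y : f (x + y) = f x + f y.
  have [[Mx MNx] [My MNy]] := (fP x, fP y).
  apply: f_uniq; first exact: convex_coneD cM Mx My.
  by rewrite !opprD; exact: convex_coneD cM MNx MNy.
have fN x : f (- x) = - f x.
  by have [Mx MNx] := fP x; apply: f_uniq => //; rewrite !opprK.
have fpZ a x : 0 <= a -> f (a *: x) = a * f x.
  move=> a0; have [Mx MNx] := fP x.
  apply: f_uniq; first exact: (convex_coneZ cM a0 Mx).
  by rewrite -scalerN -mulrN; exact: (convex_coneZ cM a0 MNx).
have fZ a x : f (a *: x) = a * f x.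
  have [/fpZ//|a0] := leP 0 a.
  by rewrite -[LHS]opprK -fN -scaleNr fpZ ?oppr_ge0 1?ltW// mulNr opprK.
have flin : scalar f by move=> a x y; rewrite fD fZ.
pose w : {scalar E} :=
  HB.pack_for {scalar E} f (GRing.isLinear.Build _ _ _ _ f flin).
by exists w => z r /CM Mr; apply: gap Mr _; exact: (fP z).2.
Qed.

End HahnBanach.

(** * Duality under the interior point condition *)

Section ConicFarkas.
Context (R : realType) (X Z : lmodType R).
Context (A : {linear X -> Z}) (P : set X) (Q : set Z) (b : Z).
Context (coneP : convex_cone P) (coneQ : convex_cone Q).

(** Up to taking infima over the second coordinate, this is the homogenized
    value function, in terms of the perturbation [z] of the constraint, of the
    problem of minimizing [g - r]: the variable [t] homogenizes both the
    right-hand side [b] and the lower bound [r]. *)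
Definition perturbation_cone (g : algdual X) (r : R) : set (Z * R^o) :=
  [set p | exists x t, [/\ P x, 0 <= t, Q (A x - t *: b - p.1) &
    p.2 = g x - t * r]].

Lemma convex_cone_perturbation (g : algdual X) (r : R) :
  convex_cone (perturbation_cone g r).
Proof.
split.
  exists 0, 0, 0; split => //=; first exact: convex_cone0.
    by rewrite linear0 scale0r !subr0; exact: convex_cone0.
  by rewrite linear0 mul0r subr0.
move=> a d [z1 s1] [z2 s2] a0 d0 [x [t [Px t0 /= Qx ->]]]
  [y [u [Py u0 /= Qy ->]]].
exists (a *: x + d *: y), (a * t + d * u); split.
- exact: coneP.2.
- by rewrite addr_ge0 ?mulr_ge0.
- have := coneQ.2 _ _ _ _ a0 d0 Qx Qy; congr Q => /=.
  rewrite (linearD A) !(linearZ_LR A) /=.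
  rewrite !(scalerDr, scalerN, scalerA, scalerDl).
  by rewrite !opprD addrACA [X in X + _ = _]addrACA.
- rewrite /= (linearD g) !(linearZ_LR g) /= /GRing.scale /=; lra.
Qed.

(** For [t > 0] the point [x / t] is feasible, whence [r <= g (x / t)].  For
    [t = 0] the vector [x] is a recession direction of the feasible set, and
    [g] being bounded below there cannot be negative at [x]. *)
Lemma nonneg_over0_perturbation (g : algdual X) (r : R) :
  feasible_primal A P Q b !=set0 ->
  (forall x, feasible_primal A P Q b x -> r <= g x) ->
  nonneg_over0 (perturbation_cone g r).
Proof.
move=> [x0 [Px0 Qx0]] bnd s [x [t [Px t0 /=]]]; rewrite subr0 => Qx ->.
move: t0; rewrite le_eqVlt => /predU1P[t0|t0].
  move: Qx; rewrite -t0 scale0r mul0r !subr0 => Qx.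
  rewrite leNgt; apply/negP => gx0.
  (* Moving from [x0] by this multiple of [x] brings [g] below [r]. *)
  pose a := (`|g x0 - r| + 1) / - g x.
  have a0 : 0 <= a by apply: divr_ge0; [rewrite addr_ge0|rewrite oppr_ge0 ltW].
  have : r <= g (x0 + a *: x).
    apply: bnd; split; first by apply: convex_coneD => //; exact: convex_coneZ.
    rewrite linearD linearZ /= addrAC.
    by apply: convex_coneD => //; exact: convex_coneZ.
  rewrite linearD linearZ /=.
  have -> : a * g x = - (`|g x0 - r| + 1).
    by rewrite /a invrN mulrN mulNr divfK// lt_eqF.
  have := ler_norm (g x0 - r); lra.
have ti : 0 <= t^-1 by rewrite invr_ge0 ltW.
have : r <= g (t^-1 *: x).
  apply: bnd; split; first exact: convex_coneZ.
  have := convex_coneZ coneQ ti Qx.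
  by rewrite scalerBr scalerA mulVf ?gt_eqF// scale1r linearZ.
by rewrite linearZ /= -(ler_pM2l t0) mulrA mulfV ?gt_eqF// mul1r subr_ge0.
Qed.

Lemma perturbation_cone_total (g : algdual X) (r : R) xbar :
  P xbar -> core Q (A xbar - b) ->
  forall z, exists s, perturbation_cone g r (z, s).
Proof.
move=> Px Qx z; have [e e0 /(_ e)] := Qx (- z).
rewrite lexx ltW// => /(_ isT) Qe.
have ei : 0 <= e^-1 by rewrite invr_ge0 ltW.
exists (g (e^-1 *: xbar) - e^-1 * r), (e^-1 *: xbar), e^-1; split => //.
  exact: convex_coneZ.
have := convex_coneZ coneQ ei Qe; congr Q => /=.
by rewrite scalerDr scalerBr scalerA mulVf ?gt_eqF// scale1r (linearZ_LR A).
Qed.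

(** Nonhomogeneous Farkas lemma: an affine inequality valid on the primal
    feasible set is certified by a dual multiplier [w]. *)
Lemma conic_farkas (g : algdual X) (r : R) xbar :
  P xbar -> core Q (A xbar - b) ->
  feasible_primal A P Q b !=set0 ->
  (forall x, feasible_primal A P Q b x -> r <= g x) ->
  exists w : algdual Z,
    [/\ dual_cone Q w, dual_cone P (g - adjoint A w) & r <= w b].
Proof.
move=> Px Qx fP bnd.
have [w wle] := hahn_banach_cone (convex_cone_perturbation g r)
  (nonneg_over0_perturbation fP bnd) (perturbation_cone_total g r Px Qx).
exists w; split.
- move=> q Qq; rewrite -oppr_le0 -linearN; apply: wle.
  exists 0, 0; split => //=; first exact: convex_cone0.
    by rewrite linear0 scale0r !sub0r oppr0 add0r opprK.
  by rewrite linear0 mul0r subr0.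
- move=> x Px'; rewrite algdualBE subr_ge0 /=; apply: wle.
  exists x, 0; split => //=; last by rewrite mul0r subr0.
  by rewrite scale0r subr0 subrr; exact: convex_cone0.
- rewrite -lerN2 -linearN; apply: wle.
  exists 0, 1; split => //=; first exact: convex_cone0.
    by rewrite linear0 scale1r sub0r subrr; exact: convex_cone0.
  by rewrite linear0 mul1r sub0r.
Qed.

End ConicFarkas.

Lemma Kset_sub_Mset (R : realType) (X Z : lmodType R) (A : {linear X -> Z})
  (P : set X) (Q : set Z) (b : Z) (c : algdual X) :
  Kset A P Q b c `<=` Mset A P Q b c.
Proof.
move=> [y r] [w Qw [[p Pp /= <-] /= rw]].
apply/ereal_infP => _ [x [Px Qx] <-]; rewrite lee_fin.
have := Qw _ Qx; rewrite linearB /= subr_ge0 => wbA.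
have px := Pp _ Px.
lra.
Qed.

Theorem theorem5p3 (R : realType) (X Z : lmodType R) (A : {linear X -> Z})
  (P : set X) (Q : set Z) (b : Z) (c : algdual X)
  (coneP : convex_cone P) (coneQ : convex_cone Q)
  (primal_feasible : feasible_primal A P Q b !=set0)
  (dual_feasible : feasible_dual A P Q c !=set0) :
  (exists2 xbar : X, P xbar & core Q (A xbar - b)) ->
  Kset A P Q b c = Mset A P Q b c.
Proof.
move=> [xbar Pxbar Qxbar]; apply/seteqP; split; first exact: Kset_sub_Mset.
move=> [y r] /= My.
have bnd x : feasible_primal A P Q b x -> r <= (c - y) x.
  move=> fx; rewrite -lee_fin; apply: le_trans My _.
  by apply: ereal_inf_lbound; exists x.
have [w [Qw Pw rw]] := conic_farkas coneP coneQ Pxbar Qxbar primal_feasible bnd.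
exists w => //; split => //=; exists (c - y - adjoint A w) => //.
by rewrite !opprB addrACA addNr add0r addrC subrK.
Qed.
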